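(* Let $0<\varepsilon<\frac12$ and $0<\delta<1$. Let $n_1<n_2<\cdots<n_s$ be a sequence of sample sizes such that $n_s\ge\frac{\ln\frac{2s}{\delta}}{2\varepsilon^2}$. Define $\widehat\mu_\ell=\frac1{n_\ell}\sum_{i=1}^{n_\ell}Z_i$ for $\ell=1,\ldots,s$. Suppose the stopping rule is that sampling is continued until $$\left(\left|\widehat\mu_\ell-\tfrac12\right|-\tfrac{2\varepsilon}{3}\right)^2\ge\frac14-\frac{\varepsilon^2n_\ell}{2\ln(2s/\delta)}$$ for some $\ell\in\{1,\ldots,s\}$. Define $\widehat\mu=\frac1{\mathbf n}\sum_{i=1}^{\mathbf n}Z_i$, where $\mathbf n$ is the sample size when the sampling is terminated. Then $\Pr\{|\widehat\mu-\mu|<\varepsilon\}\ge1-\delta$.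
   Context: $Z$ is a random variable with values in $[0,1]$ and expectation $\mu=\mathbb E[Z]$; $Z_1,Z_2,\ldots$ are i.i.d. random samples of $Z$. Sample sizes are positive integers. Sampling stops at the smallest index $\ell$ for which the displayed inequality holds, and then $\mathbf n=n_\ell$. *)

(* Defs.v *)
From HB Require Import structures.
From mathcomp Require Import all_boot all_order all_algebra.
From mathcomp Require Import all_classical all_reals all_analysis.
From mathcomp Require Import lra.
Import Order.TTheory GRing.Theory Num.Theory.
Import numFieldNormedType.Exports.

Set Implicit Arguments.
Unset Strict Implicit.
Unset Printing Implicit Defensive.

Local Open Scope classical_set_scope.
Local Open Scope ring_scope.

(* The product rule for arbitrary finite families of distinct indices. *)
Definition mutually_independent (R : realType) (d : measure_display)
    (T : measurableType d) (P : probability T R) (X : nat -> {RV P >-> R}) :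
    Prop :=
  forall (J : seq nat) (A : nat -> set R),
    uniq J -> (forall i, measurable (A i)) ->
    P (\bigcap_(i in [set` J]) X i @^-1` A i) =
    (\prod_(i <- J) P (X i @^-1` A i))%E.

(* The laws may live on different probability spaces, so they are compared on
   measurable sets only. *)
Definition same_law (R : realType) (d d' : measure_display)
    (T : measurableType d) (T' : measurableType d')
    (P : probability T R) (Q : probability T' R)
    (X : {RV P >-> R}) (Y : {RV Q >-> R}) : Prop :=
  forall A : set R, measurable A -> distribution P X A = distribution Q Y A.

Definition iid_samples (R : realType) (d d' : measure_display)
    (T : measurableType d) (T' : measurableType d')
    (P : probability T R) (Q : probability T' R)
    (X : nat -> {RV P >-> R}) (Z : {RV Q >-> R}) : Prop :=
  mutually_independent X /\ forall i, same_law (X i) Z.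

(* Samples are numbered from 0: X i is the (i+1)-st sample. *)
Definition sample_mean (R : realType) (d : measure_display)
    (T : measurableType d) (P : probability T R) (X : nat -> {RV P >-> R})
    (m : nat) (t : T) : R :=
  (\sum_(i < m) X i t) / m%:R.

(* Stages are numbered 1, ..., s; only n 1, ..., n s are sample sizes. *)
Definition stop_at (R : realType) (d : measure_display)
    (T : measurableType d) (P : probability T R) (X : nat -> {RV P >-> R})
    (n : nat -> nat) (s : nat) (eps delta : R) (t : T) (l : nat) : bool :=
  4^-1 - eps ^+ 2 * (n l)%:R / (2 * ln (2 * s%:R / delta))
    <= (`|sample_mean X (n l) t - 2^-1| - 2 * eps / 3) ^+ 2.

(* The smallest l in {1, ..., s} at which the inequality holds; it would be s+1
   if there were none, which stop_indexP excludes. *)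
Definition stop_index (R : realType) (d : measure_display)
    (T : measurableType d) (P : probability T R) (X : nat -> {RV P >-> R})
    (n : nat -> nat) (s : nat) (eps delta : R) (t : T) : nat :=
  (find (stop_at X n s eps delta t) (iota 1 s)).+1.

Definition final_size (R : realType) (d : measure_display)
    (T : measurableType d) (P : probability T R) (X : nat -> {RV P >-> R})
    (n : nat -> nat) (s : nat) (eps delta : R) (t : T) : nat :=
  n (stop_index X n s eps delta t).

Lemma stop_indexP (R : realType) (d : measure_display)
    (T : measurableType d) (P : probability T R) (X : nat -> {RV P >-> R})
    (n : nat -> nat) (s : nat) (eps delta : R) (t : T) :
  (0 < s)%N -> 0 < eps -> 0 < delta < 1 ->
  ln (2 * s%:R / delta) / (2 * eps ^+ 2) <= (n s)%:R ->
  let L := stop_index X n s eps delta t in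
  [/\ (1 <= L <= s)%N, stop_at X n s eps delta t L &
      forall l, (1 <= l < L)%N -> ~~ stop_at X n s eps delta t l].
Proof.
move=> s0 e0 /andP[d0 d1] hn.
have stops : has (stop_at X n s eps delta t) (iota 1 s).
  apply/hasP; exists s; first by rewrite mem_iota s0 add1n /=.
  apply: le_trans (sqr_ge0 _).
  have ln0 : 0 < ln (2 * s%:R / delta).
    apply: ln_gt0; rewrite ltr_pdivlMr // mul1r (lt_le_trans d1) //.
    by rewrite -natrM ler1n muln_gt0.
  rewrite subr_le0 ler_pdivlMr ?mulr_gt0 //.
  move: hn; rewrite ler_pdivrMr ?mulr_gt0 ?exprn_gt0 // => hn.
  lra.
rewrite /stop_index; split.
- by move: stops; rewrite has_find size_iota.
- have := nth_find 0%N stops; rewrite nth_iota ?add1n //.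
  by move: stops; rewrite has_find size_iota.
- case=> [//|l] /=; rewrite ltnS => hl.
  have := before_find 0%N hl; rewrite nth_iota ?add1n => [->//|].
  by apply: leq_trans hl _; rewrite -[leqRHS](size_iota 1) find_size.
Qed.

(* Main.v *)
(* By convexity exp (t z) <= 1 - z + z exp t on [0, 1], so Chernoff's method
   bounds the tails of the sample mean as for Bernoulli(mu) variables, and the
   relative entropy of p + e to p is at least e^2 / (2 w (1 - w)) with
   w = p + e/3 (Massart). Suppose sampling stops at stage l with a mean z
   satisfying z >= mu + eps. With p = z - eps >= mu we have w = z - 2 eps/3, and
   the stopping inequality gives w (1 - w) <= eps^2 n_l / (2 ln (2s/delta)),
   that is, the Massart exponent times n_l is at least ln (2s/delta). Such an
   event has probability at most delta/(2s); underestimation is symmetric under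
   z |-> 1 - z, and a union bound over the s stages and two sides concludes. *)

Require Import Defs.
From HB Require Import structures.
From mathcomp Require Import all_boot all_order all_algebra.
From mathcomp Require Import all_classical all_reals all_analysis.
From mathcomp Require Import measurable_realfun.
From mathcomp Require Import ring lra.
Import Order.TTheory GRing.Theory Num.Theory.
Import numFieldNormedType.Exports.

Set Implicit Arguments.
Unset Strict Implicit.
Unset Printing Implicit Defensive.

Local Open Scope classical_set_scope.
Local Open Scope ring_scope.

(** * Logarithm inequalities and the Massart exponent *)

(* Integrating the tangent line of 1/u twice gives this Pade bound; the
   derivative of the difference is (x - 1)^3 / (x^2 (x + 2)^2). *)
Lemma ln_ge_pade (R : realType) (x : R) : 0 < x ->
  (x - 1) * (5 * x + 1) / (2 * x * (x + 2)) <= ln x.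
Proof.
move=> x0.
pose h (y : R) : R := ln y - (y - 1) * (5 * y + 1) * (2 * y * (y + 2))^-1.
pose dh (y : R) : R := (y - 1) ^+ 3 / (y ^+ 2 * (y + 2) ^+ 2).
have dhE (y : R) : 0 < y -> is_derive y 1 h (dh y).
  move=> y0; rewrite /h.
  have ? := is_derive1_ln y0.
  have q0 : 2 * y * (y + 2) != 0 by nra.
  have ? : is_derive y 1 (fun z : R => (2 * z * (z + 2))^-1)
      (- (2 * y * (y + 2)) ^- 2 *: (4 * y + 4)).
    apply: is_deriveV => //.
    apply: is_derive_eq; rewrite /GRing.scale /=; ring.
  apply: is_derive_eq; rewrite /GRing.scale /dh /=; field.
  by apply/andP; split; nra.
have cont a b : 0 < a -> {within `[a, b], continuous h}.
  move=> a0; apply: derivable_within_continuous => y.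
  rewrite in_itv/= => /andP[ay _].
  by have [] := dhE _ (lt_le_trans a0 ay).
have h1 : h 1 = 0 by rewrite /h ln1 subrr !mul0r subrr.
rewrite -subr_ge0 -/(h x).
have [x1|x1|->] := ltgtP x 1; last by rewrite h1.
- have d y : y \in `]x, 1[ -> is_derive y 1 h (dh y).
    rewrite in_itv/= => /andP[xy _]; exact/dhE/(lt_trans x0).
  have [y yi hE] := MVT x1 d (cont x 1 x0).
  move: yi; rewrite in_itv/= => /andP[xy y1].
  have : dh y <= 0.
    rewrite /dh pmulr_lle0 ?exprn_odd_le0 ?subr_le0 ?ltW//.
    by rewrite invr_gt0; nra.
  by move: hE; rewrite h1; nra.
- have d y : y \in `]1, x[ -> is_derive y 1 h (dh y).
    rewrite in_itv/= => /andP[y1 _]; exact/dhE/(lt_trans ltr01).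
  have [y yi hE] := MVT x1 d (cont 1 x ltr01).
  move: yi; rewrite in_itv/= => /andP[y1 yx].
  have : 0 <= dh y.
    rewrite /dh mulr_ge0 ?exprn_ge0 ?subr_ge0 ?ltW//.
    by rewrite invr_gt0; nra.
  by move: hE; rewrite h1; nra.
Qed.

(** This is [ln_ge_pade] at a / b, multiplied by a. The linear part a - b is split off because it
    cancels when the terms for (z, p) and (1 - z, 1 - p) are added. *)
Lemma relative_entropy_term_ge (R : realType) (a b : R) : 0 < a -> 0 < b ->
  a - b + 3 * (a - b) ^+ 2 / (2 * (2 * b + a)) <= a * (ln a - ln b).
Proof.
move=> a0 b0; rewrite -ln_div ?posrE//.
have := ln_ge_pade (divr_gt0 a0 b0).
rewrite -(ler_pM2l a0); apply: le_trans.
rewrite le_eqVlt; apply/orP; left; apply/eqP; field.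
by repeat (apply/andP; split); nra.
Qed.

(** The left side is the Chernoff factor of a Bernoulli(p) variable at level p + e, whose infimum
    over t is the exponential of minus the relative entropy. For p = 0 or p + e = 1 that infimum is
    not attained, so another finite t is chosen. *)
Lemma massart_exponent (R : realType) (p e : R) :
  0 <= p -> 0 < e -> p + e <= 1 ->
  exists2 t, 0 <= t & expR (- (t * (p + e))) * (1 - p + p * expR t) <=
    expR (- (e ^+ 2 / (2 * ((p + e / 3) * (1 - (p + e / 3)))))).
Proof.
move=> p0 e0 pe1; set w := p + e / 3.
have w0 : 0 < w by rewrite /w; lra.
have w1 : 0 < 1 - w by rewrite /w; lra.
have ww : 0 < w * (1 - w) by rewrite mulr_gt0.
have [p0'|pgt0] := ltP 0 p; last first.
  have {pgt0} p00 : p = 0 by lra.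
  (* For p = 0 only exp (- t e) remains, and this t makes t e the required exponent. *)
  exists (e / (2 * (w * (1 - w)))).
    by apply: divr_ge0; [exact: ltW|nra].
  rewrite p00 !(add0r, mul0r, subr0, addr0, mulr1) ler_expR.
  by rewrite lerN2 expr2 mulrAC.
have [pe|pe] := ltP (p + e) 1.
  have [z zE] : exists z, z = p + e by exists (p + e).
  rewrite -zE in pe pe1 *.
  have z0 : 0 < z by lra.
  (* The optimal tilt: it moves the mean of Bernoulli(p) to z, and the logarithm of the left side
     becomes minus the relative entropy of z to p. *)
  exists (ln z - ln p + (ln (1 - p) - ln (1 - z))).
    apply: addr_ge0; rewrite subr_ge0 ler_ln ?posrE//; lra.
  have -> : 1 - p + p * expR (ln z - ln p + (ln (1 - p) - ln (1 - z))) =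
      expR (ln (1 - p) - ln (1 - z)).
    rewrite !(expRD, expRN) !lnK ?posrE; try lra.
    by field; apply/andP; split; lra.
  rewrite -expRD ler_expR.
  have A := relative_entropy_term_ge z0 p0'.
  have B : 1 - z - (1 - p) + 3 * (1 - z - (1 - p)) ^+ 2 /
      (2 * (2 * (1 - p) + (1 - z))) <= (1 - z) * (ln (1 - z) - ln (1 - p)).
    by apply: relative_entropy_term_ge; lra.
  (* Here 2 p + z = 3 w and 2 (1 - p) + (1 - z) = 3 (1 - w), so the sum is e^2/(2 w) + e^2/(2 (1 -
     w)). *)
  have E : e ^+ 2 / (2 * (w * (1 - w))) =
     3 * (z - p) ^+ 2 / (2 * (2 * p + z)) +
     3 * (1 - z - (1 - p)) ^+ 2 / (2 * (2 * (1 - p) + (1 - z))).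
    rewrite zE /w; field.
    by repeat (apply/andP; split); rewrite /w in w0 w1; lra.
  rewrite E; lra.
have {pe}pE : p = 1 - e by lra.
have z1 : p + e = 1 by lra.
rewrite z1.
set c := e ^+ 2 / (2 * (w * (1 - w))).
have c0 : 0 < c by apply: divr_gt0; [nra|nra].
(* Here the optimal tilt is infinite, but the inequality is strict. *)
have pc : p < expR (- c).
  rewrite -[ltLHS]lnK ?posrE// ltr_expR.
  have := relative_entropy_term_ge ltr01 p0'; rewrite ln1 => A.
  (* The entropy bound [A] has the full linear term 1 - p = e where c has only 3 e / 4; this gap
     gives strictness. *)
  have E : c = 3 * (1 - p) ^+ 2 / (2 * (2 * p + 1)) + 3 / 4 * e.
    rewrite /c /w pE; field.
    by repeat (apply/andP; split); rewrite /w in w0 w1; lra.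
  rewrite E; lra.
have c1 : expR (- c) < 1 by rewrite -expR0 ltr_expR; lra.
have q0 : 0 < (expR (- c) - p) / e by apply: divr_gt0; lra.
move: (expR (- c)) pc c1 q0 => x px x1 q0.
(* As 1 - p = e, the left side is e exp (- t) + p; this t makes it equal to x. *)
exists (- ln ((x - p) / e)).
  by rewrite oppr_ge0 ln_le0// ler_pdivrMr//; lra.
rewrite mulr1 opprK expRN lnK ?posrE//.
rewrite le_eqVlt; apply/orP; left; apply/eqP.
have -> : 1 - p = e by lra.
field.
by apply/andP; split; lra.
Qed.

(* The points where the stopping rule fires with estimation error at least eps
   need not form an interval, but they all lie above the least of them, which is
   itself such a point; the Massart exponent there is already large enough. *)
Lemma stopping_threshold (R : realType) (mu e c : R) :
  0 <= mu <= 1 -> 0 < e -> 0 < c ->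
  exists z0 t, [/\ 0 <= t,
    forall z, mu + e <= z <= 1 ->
      (z - 2 * e / 3) * (1 - (z - 2 * e / 3)) <= c -> z0 <= z &
    expR (- (t * z0)) * (1 - mu + mu * expR t) <= expR (- (e ^+ 2 / (2 * c)))].
Proof.
move=> /andP[mu0 mu1] e0 c0.
pose g (z : R) : R := (z - 2 * e / 3) * (1 - (z - 2 * e / 3)).
pose S := `[mu + e, 1]%classic `&` [set z | g z <= c].
have cS : compact S.
  apply: compact_closedI; first exact: segment_compact.
  have -> : [set z | g z <= c] = g @^-1` [set y | y <= c] by [].
  apply: closed_comp; last exact: closed_le.
  by move=> z _; apply: differentiable_continuous.
have inS z : mu + e <= z <= 1 -> g z <= c -> S z.
  by move=> zi gz; split => //=; rewrite in_itv.
have [S0|S0] := pselect (S !=set0); last first.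
  (* With no such point any threshold is valid. At 2 the left side is at most exp (- 2 t) exp t =
     exp (- t), which dictates t. *)
  exists 2, (e ^+ 2 / (2 * c)); split.
  - by apply: divr_ge0; nra.
  - by move=> z zi gz; exfalso; apply: S0; exists z; apply: inS.
  - set t := _ / _; have t0 : 0 <= t by apply: divr_ge0; nra.
    have et : 1 <= expR t by rewrite -expR0 ler_expR.
    apply: (@le_trans _ _ (expR (- (t * 2)) * expR t)).
      rewrite ler_wpM2l ?expR_ge0//; nra.
    by rewrite -expRD ler_expR; lra.
have [z0 z0S z0min] := compact_EVT_min S0 cS
  (continuous_subspaceT (fun x => cvg_id : id y @[y --> x] --> id x)).
move: z0S; rewrite inE => -[/=]; rewrite in_itv/= => /andP[z0l z0u] gz0.
have p0 : 0 <= z0 - e by lra.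
have pe : z0 - e + e <= 1 by lra.
have [t t0 tb] := massart_exponent p0 e0 pe.
exists z0, t; split => //.
  by move=> z zi gz; apply: z0min; rewrite inE; apply: inS.
have et : 1 <= expR t by rewrite -expR0 ler_expR.
move: tb; rewrite subrK.
have -> : z0 - e + e / 3 = z0 - 2 * e / 3 by field.
rewrite -/(g z0) => tb.
(* The exponent was taken at p = z0 - e >= mu, and 1 - p + p exp t is nondecreasing in p because exp
   t >= 1. *)
apply: (@le_trans _ _ (expR (- (t * z0)) * (1 - (z0 - e) + (z0 - e) * expR t))).
  by rewrite ler_wpM2l ?expR_ge0//; nra.
apply: le_trans tb _; rewrite ler_expR lerN2 ler_pM2l ?exprn_gt0//.
have gpos : 0 < g z0 by apply: mulr_gt0; lra.
by rewrite lef_pV2 ?posrE; lra.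
Qed.

(** * Expectations of products of independent variables *)

Import HBNNSimple.

(** Factorization on events of X passes to simple functions by linearity, then to nonnegative
    measurable f by monotone convergence. *)
Lemma ge0_integral_factor (R : realType) (d : measure_display)
    (T : measurableType d) (P : probability T R) (X : {RV P >-> R})
    (g : T -> R) (c : R) (f : R -> R) :
  measurable_fun [set: T] g -> (forall t, 0 <= g t) -> 0 <= c ->
  (forall A, measurable A ->
    (\int[P]_t ((g t)%:E * (\1_A (X t))%:E) = c%:E * P (X @^-1` A))%E) ->
  measurable_fun [set: R] f -> (forall x, 0 <= f x) ->
  (\int[P]_t ((g t)%:E * (f (X t))%:E) = c%:E * \int[P]_t (f (X t))%:E)%E.
Proof.
move=> mg g0 c0 gc mf f0.
have mgE : measurable_fun [set: T] (EFin \o g) by exact/measurable_EFinP.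
have gE0 t : (0 <= (g t)%:E)%E by rewrite lee_fin.
have cE0 : (0 <= c%:E)%E by rewrite lee_fin.
have mcomp (h : R -> R) : measurable_fun [set: R] h ->
    measurable_fun [set: T] (fun t => (h (X t))%:E).
  by move=> mh; apply/measurable_EFinP; exact: measurableT_comp.
have simple (h : {nnsfun R >-> R}) :
    (\int[P]_t ((g t)%:E * (h (X t))%:E) = c%:E * \int[P]_t (h (X t))%:E)%E.
  pose u y x : \bar R := (y%:E * (\1_(h @^-1` [set y]) x)%:E)%E.
  have u0 y x : (0 <= u y x)%E by exact: nnfun_muleindic_ge0.
  have mu y : measurable_fun [set: T] (fun t => u y (X t)).
    by apply: measurable_funeM; apply: mcomp; exact: measurable_indic.
  pose s := finmap.enum_fset (fset_set (range h)).
  have hE x : ((h x)%:E = \sum_(y <- s) u y x)%E.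
    by rewrite fimfunE fsbig_finite//= -sumEFin.
  under eq_integral do rewrite hE ge0_sume_distrr//.
  under [in RHS]eq_integral do rewrite hE.
  rewrite !ge0_integral_sum//; first last.
  - by move=> y t _; rewrite mule_ge0.
  - by move=> y; exact: emeasurable_funM.
  rewrite ge0_sume_distrr; last by move=> y _; apply: integral_ge0.
  (* Keeping y in the range of h makes it nonnegative, so it can leave the integral. *)
  rewrite big_seq [RHS]big_seq; apply: eq_bigr => y.
  rewrite in_fset_set// inE => -[x _ hxy].
  have y0 : (0 <= y%:E)%E by rewrite lee_fin -hxy.
  under eq_integral do rewrite /u muleCA.
  have m1 : measurable_fun [set: T]
      (fun t => (\1_(h @^-1` [set y]) (X t) : R)%:E).
    by apply: (mcomp (\1_(h @^-1` [set y]))); exact: measurable_indic.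
  rewrite !ge0_integralZl//; first last.
  - by move=> t _; rewrite mule_ge0.
  - exact: emeasurable_funM.
  rewrite gc// muleCA; congr (_ * (_ * _))%E.
  have mXh : measurable (X @^-1` (h @^-1` [set y])).
    exact: measurable_funPTI.
  have := integral_indic P measurableT mXh; rewrite setIT => <-.
  by apply: eq_integral => t _; rewrite !indicE.
have mEf : measurable_fun [set: R] (EFin \o f) by exact/measurable_EFinP.
pose F := nnsfun_approx measurableT mEf.
have Fcvg x : (F n x)%:E @[n --> \oo] --> (f x)%:E.
  by apply: cvg_nnsfun_approx => // y _; rewrite lee_fin.
have Fnd x : nondecreasing_seq (fun n => (F n x)%:E).
  by move=> a b ab; rewrite lee_fin; exact/lefP/nd_nnsfun_approx.
have F0 n x : (0 <= (F n x)%:E)%E by rewrite lee_fin.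
transitivity (limn (fun n => \int[P]_t ((g t)%:E * (F n (X t))%:E)))%E.
  rewrite -monotone_convergence//.
  - apply: eq_integral => t _; apply/esym/cvg_lim => //.
    exact: cvgeZl.
  - by move=> n; apply: emeasurable_funM => //; exact: mcomp.
  - by move=> n t _; rewrite mule_ge0.
  - by move=> t _ a b ab; rewrite lee_wpmul2l//; exact: Fnd.
have -> : (\int[P]_t (f (X t))%:E = limn (fun n => \int[P]_t (F n (X t))%:E))%E.
  rewrite -monotone_convergence//.
  - by apply: eq_integral => t _; apply/esym/cvg_lim.
  - by move=> n; exact: mcomp.
rewrite -limeMl//; last first.
  apply/ereal_nondecreasing_is_cvgn => a b ab; apply: ge0_le_integral => //.
  - exact: mcomp.
  - exact: mcomp.
  - by move=> t _; exact: Fnd.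
by congr (limn _); apply/funext => n.
Qed.

Lemma measurable_superlevel (R : realType) (d : measure_display)
    (T : measurableType d) (f : T -> R) (a : R) :
  measurable_fun [set: T] f -> measurable [set t | a <= f t].
Proof.
move=> mf; rewrite -[X in measurable X]setTI.
rewrite (_ : [set t | _] = f @^-1` `[a, +oo[); first exact: mf.
by apply/seteqP; split => t; rewrite /= in_itv/= andbT.
Qed.

Lemma expectation_prod_indep (R : realType) (d : measure_display)
    (T : measurableType d) (P : probability T R) (X : nat -> {RV P >-> R})
    (f : R -> R) (e : nat -> R) :
  mutually_independent X ->
  measurable_fun [set: R] f -> (forall x, 0 <= f x) ->
  (forall i, (\int[P]_t (f (X i t))%:E = (e i)%:E)%E) ->
  forall k, (\int[P]_t (\prod_(i < k) f (X i t))%:E = (\prod_(i < k) e i)%:E)%E.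
Proof.
move=> ind mf f0 fe.
have mpre i A : measurable A -> measurable (X i @^-1` A).
  exact: measurable_funPTI.
have e0 i : 0 <= e i.
  by rewrite -lee_fin -fe; apply: integral_ge0 => t _; rewrite lee_fin.
have mprod k : measurable_fun [set: T] (fun t => \prod_(i < k) f (X i t)).
  by apply: measurable_prod => i _; exact: measurableT_comp.
(* Carrying the events of the variables still to come makes induction on k
   possible. *)
suff H k : forall (J : seq nat) (A : nat -> set R),
    uniq J -> (forall j, j \in J -> k <= j)%N -> (forall j, measurable (A j)) ->
    (\int[P]_t (\prod_(i < k) f (X i t) *
       \1_(\bigcap_(j in [set` J]) X j @^-1` A j) t)%:E =
     (\prod_(i < k) e i * \prod_(j <- J) fine (P (X j @^-1` A j)))%:E)%E.
  move=> k; have := H k [::] (fun=> setT) isT.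
  rewrite big_nil mulr1 => <- //.
  apply: eq_integral => t _; rewrite indicE mem_set ?mulr1//.
elim: k => [|k IH] J A uJ Jk mA.
  under eq_integral do rewrite big_ord0 mul1r.
  rewrite integral_indic ?setIT//; last first.
    by apply: fin_bigcap_measurable => // j _; exact: mpre.
  transitivity (\prod_(j <- J) P (X j @^-1` A j))%E; first exact: ind.
  rewrite big_ord0 mul1r (big_morph EFin EFinM erefl); apply: eq_bigr => j _.
  by rewrite fineK// fin_num_measure//; exact: mpre.
have kJ : k \notin J by apply/negP => /Jk; rewrite ltnn.
have mI : measurable (\bigcap_(j in [set` J]) X j @^-1` A j).
  by apply: fin_bigcap_measurable => // j _; exact: mpre.
pose g t : R := \prod_(i < k) f (X i t) *
  \1_(\bigcap_(j in [set` J]) X j @^-1` A j) t.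
pose c : R := \prod_(i < k) e i * \prod_(j <- J) fine (P (X j @^-1` A j)).
transitivity (\int[P]_t ((g t)%:E * (f (X k t))%:E))%E.
  by apply: eq_integral => t _; rewrite -EFinM big_ord_recr/= mulrAC.
have c0 : 0 <= c.
  apply: mulr_ge0; first exact: prodr_ge0.
  by apply: prodr_ge0 => j _; rewrite fine_ge0.
rewrite (@ge0_integral_factor _ _ _ _ _ _ c)//.
- by rewrite fe -EFinM /c big_ord_recr/= mulrAC.
- by apply: measurable_funM => //; exact: measurable_indic.
- by move=> t; rewrite mulr_ge0// prodr_ge0.
move=> B mB.
(* The event that X k lies in B joins those indexed by J; the induction hypothesis for [k :: J] is
   then the factorization required of g. *)
pose A' j := if j == k then B else A j.
have A'J j : j \in J -> A' j = A j.
  by rewrite /A'; case: eqP => // -> jJ; rewrite jJ in kJ.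
have := IH (k :: J) A'; rewrite /= kJ uJ => /(_ isT) IHk.
transitivity (\int[P]_t (\prod_(i < k) f (X i t) *
       \1_(\bigcap_(j in [set` k :: J]) X j @^-1` A' j) t)%:E)%E.
  apply: eq_integral => t _; rewrite -EFinM -mulrA; congr (_ * _)%:E.
  rewrite !indicE -natrM mulnb; congr (_%:R); congr nat_of_bool.
  apply/andP/idP => [[/set_mem HJ /set_mem HB]|/set_mem HkJ].
    apply/mem_set => j /=; rewrite inE => /orP[/eqP ->|jJ].
      by rewrite /preimage/= /A' eqxx.
    by rewrite A'J//; exact: HJ.
  split; apply/mem_set.
    by move=> j /= jJ; rewrite -A'J//; apply: HkJ; rewrite /= inE jJ orbT.
  by have := HkJ k; rewrite /= mem_head /preimage/= /A' eqxx; apply.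
rewrite IHk; first last.
- by move=> j; rewrite /A'; case: ifP.
- by move=> j; rewrite inE => /orP[/eqP ->//|/Jk/ltnW].
rewrite big_cons /A' eqxx -/(A' _).
rewrite (eq_big_seq (fun j => fine (P (X j @^-1` A j)))); last first.
  by move=> j /A'J jA; rewrite -[in RHS]jA.
rewrite mulrCA mulrC EFinM fineK// fin_num_measure//; exact: mpre.
Qed.

(** * Chernoff bound for samples of a variable with values in [0, 1] *)

(** Z and 1 - Z are nonnegative and add up to 1, so additivity of nonnegative integrals suffices. *)
Lemma unit_rv_mean (R : realType) (d : measure_display) (T : measurableType d)
    (P : probability T R) (Z : {RV P >-> R}) (mu : R) :
  (forall t, 0 <= Z t <= 1) -> 'E_P[Z]%E = mu%:E ->
  (\int[P]_t (1 - Z t)%:E = (1 - mu)%:E)%E /\ 0 <= mu <= 1.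
Proof.
move=> Z01 ZE.
have Z0 t : 0 <= Z t by have /andP[] := Z01 t.
have Z1 t : 0 <= 1 - Z t by rewrite subr_ge0; have /andP[] := Z01 t.
have mZ : measurable_fun [set: T] Z by [].
have mEZ : measurable_fun [set: T] (fun t => (Z t)%:E).
  exact/measurable_EFinP.
have mE1Z : measurable_fun [set: T] (fun t => (1 - Z t)%:E).
  by apply/measurable_EFinP; exact: measurable_funB.
have IZ : (\int[P]_t (Z t)%:E = mu%:E)%E by rewrite -ZE unlock.
have I1 : (\int[P]_t (1 - Z t)%:E + mu%:E = 1)%E.
  rewrite -IZ -ge0_integralD//; try by move=> t _; rewrite lee_fin.
  under eq_integral do rewrite -EFinD subrK.
  by rewrite integral_cst// mul1e; exact: probability_setT.
have I2 : (\int[P]_t (1 - Z t)%:E = (1 - mu)%:E)%E.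
  by rewrite EFinB -I1 addeK.
split => //; apply/andP; split.
  by rewrite -lee_fin -IZ; apply: integral_ge0 => t _; rewrite lee_fin.
rewrite -subr_ge0 -lee_fin -I2.
by apply: integral_ge0 => t _; rewrite lee_fin.
Qed.

Lemma expR_chord (R : realType) (t z : R) : 0 <= z <= 1 ->
  expR (t * z) <= 1 - z + z * expR t.
Proof.
move=> z01.
have := @convex_expR R (Itv01 (andP z01).1 (andP z01).2) t 0.
rewrite !convRE/= expR0 /unstable.onem !mulr0 addr0 mulr1 mulrC => h.
by apply: le_trans h _; rewrite addrC.
Qed.

(** Integrating the chord bound also shows finiteness; the real witness e is the form that
    [expectation_prod_indep] takes. *)
Lemma unit_rv_mgf (R : realType) (d : measure_display) (T : measurableType d)
    (P : probability T R) (Z : {RV P >-> R}) (mu t : R) :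
  (forall w, 0 <= Z w <= 1) -> 'E_P[Z]%E = mu%:E ->
  exists2 e, (\int[P]_w (expR (t * Z w))%:E = e%:E)%E &
    0 <= e <= 1 - mu + mu * expR t.
Proof.
move=> Z01 ZE; have [I1 _] := unit_rv_mean Z01 ZE.
have Z0 w : 0 <= Z w by have /andP[] := Z01 w.
have Z1 w : 0 <= 1 - Z w by rewrite subr_ge0; have /andP[] := Z01 w.
have mZ : measurable_fun [set: T] Z by [].
have mEZ : measurable_fun [set: T] (fun w => (Z w)%:E).
  exact/measurable_EFinP.
have mE1Z : measurable_fun [set: T] (fun w => (1 - Z w)%:E).
  by apply/measurable_EFinP; exact: measurable_funB.
have mexp : measurable_fun [set: T] (fun w => (expR (t * Z w))%:E).
  apply/measurable_EFinP; apply: measurableT_comp => //.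
  exact: measurable_funM.
have IZ : (\int[P]_w (Z w)%:E = mu%:E)%E by rewrite -ZE unlock.
have I0 : (0 <= \int[P]_w (expR (t * Z w))%:E)%E.
  by apply: integral_ge0 => w _; rewrite lee_fin expR_ge0.
have Ile : (\int[P]_w (expR (t * Z w))%:E <= (1 - mu + mu * expR t)%:E)%E.
  apply: (@le_trans _ _
    (\int[P]_w ((1 - Z w)%:E + (expR t)%:E * (Z w)%:E))%E).
    apply: ge0_le_integral => //.
    - by apply: emeasurable_funD => //; exact: measurable_funeM.
    - move=> w _; rewrite -EFinM -EFinD lee_fin [expR t * _]mulrC.
      exact: expR_chord.
  rewrite ge0_integralD//;
    try by move=> w _; rewrite ?mule_ge0 ?lee_fin ?expR_ge0.
    rewrite ge0_integralZl_EFin ?expR_ge0//.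
      by rewrite I1 IZ -EFinM -EFinD lee_fin mulrC.
    by move=> w _; rewrite lee_fin.
  exact: measurable_funeM.
move: (\int[P]_w (expR (t * Z w))%:E)%E I0 Ile => [r| |]//=.
by rewrite !lee_fin => r0 rle; exists r => //; rewrite r0.
Qed.

(** Markov's inequality for the exponential of t times the sum. The sign of t is free: t >= 0 serves
    for the upper tail and t <= 0 for the lower one. *)
Lemma iid_chernoff (R : realType) (d d' : measure_display)
    (T : measurableType d) (T' : measurableType d')
    (P : probability T R) (Q : probability T' R)
    (X : nat -> {RV P >-> R}) (Z : {RV Q >-> R}) (mu t a : R) (m : nat) :
  (forall w, 0 <= Z w <= 1) -> 'E_Q[Z]%E = mu%:E -> iid_samples X Z ->
  (P [set w | (t * (a * m%:R) <= t * \sum_(i < m) X i w)%R] <=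
   ((expR (- (t * a)) * (1 - mu + mu * expR t)) ^+ m)%:E)%E.
Proof.
move=> Z01 ZE [ind law].
have [e Ze /andP[e0 ele]] := unit_rv_mgf t Z01 ZE.
have mS : measurable_fun [set: T] (fun w => t * \sum_(i < m) X i w).
  by apply: measurable_funM => //; exact: measurable_sum.
pose f (x : R) : R := expR (t * x).
have mf : measurable_fun [set: R] f.
  by apply: measurableT_comp => //; exact: measurable_funM.
have f0 x : 0 <= f x by exact: expR_ge0.
have Xe i : (\int[P]_w (f (X i w))%:E = e%:E)%E.
  have mEf : measurable_fun [set: R] (EFin \o f) by exact/measurable_EFinP.
  (* X i and Z live on different spaces, so both integrals are moved to the real line, where the two
     laws agree. *)
  transitivity (\int[distribution P (X i)]_y (f y)%:E)%E.
    by rewrite ge0_integral_distribution.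
  rewrite -Ze -[RHS](@ge0_integral_distribution _ _ _ _ _ _ Z (EFin \o f))//.
  by apply: eq_measure_integral => A mA _; exact: law.
have prodE := expectation_prod_indep ind mf f0 Xe m.
rewrite prodr_const card_ord in prodE.
set A := [set w | _].
have mA : measurable A by exact: measurable_superlevel.
have : ((expR (t * (a * m%:R)))%:E * P A <= (e ^+ m)%:E)%E.
  rewrite -prodE -[A]setIT -(integral_indic P measurableT mA).
  rewrite -ge0_integralZl_EFin ?expR_ge0//; first last.
  - by apply/measurable_EFinP; exact: measurable_indic.
  apply: ge0_le_integral => //.
  - by apply: measurable_funeM; apply/measurable_EFinP; exact: measurable_indic.
  - apply/measurable_EFinP; apply: measurable_prod => i _.
    exact: measurableT_comp.
  move=> w _; rewrite -EFinM lee_fin.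
  have -> : \prod_(i < m) f (X i w) = expR (t * \sum_(i < m) X i w).
    by rewrite mulr_sumr expR_sum.
  rewrite indicE; case: (boolP (w \in A)) => [/set_mem wA|_].
    by rewrite mulr1 ler_expR.
  by rewrite mulr0 expR_ge0.
rewrite -lee_pdivlMl ?expR_gt0// => /le_trans; apply.
rewrite -EFinM lee_fin exprMn -expRN -expRM_natl.
rewrite (_ : m%:R * - (t * a) = - (t * (a * m%:R))); last by ring.
by rewrite ler_wpM2l ?expR_ge0// lerXn2r// nnegrE// (le_trans e0).
Qed.

(** * The error event of a single stage *)

(** As w (1 - w) = 1/4 - (w - 1/2)^2, one conclusion is the rule itself; the other has the larger
    square (|z - 1/2| + 2 e / 3)^2. Which is which depends on the sign of z - 1/2. *)
Lemma stopping_rule_quadratic (R : realFieldType) (z e c : R) : 0 <= e ->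
  4^-1 - c <= (`|z - 2^-1| - 2 * e / 3) ^+ 2 ->
  (z - 2 * e / 3) * (1 - (z - 2 * e / 3)) <= c /\
  (1 - z - 2 * e / 3) * (1 - (1 - z - 2 * e / 3)) <= c.
Proof.
move=> e0; have [z2|z2] := leP 0 (z - 2^-1).
  by rewrite ger0_norm// => h; split; nra.
by rewrite ltr0_norm// => h; split; nra.
Qed.

(** [B] is built from the first m samples alone, so the union bound over stages needs no analysis of
    the stopping time. *)
Lemma stage_error (R : realType) (d d' : measure_display)
    (T : measurableType d) (T' : measurableType d')
    (P : probability T R) (Q : probability T' R)
    (X : nat -> {RV P >-> R}) (Z : {RV Q >-> R}) (mu e L : R) (m : nat) :
  (forall w, 0 <= Z w <= 1) -> 'E_Q[Z]%E = mu%:E -> iid_samples X Z ->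
  0 < e -> 0 < L -> (0 < m)%N ->
  exists B : set T, [/\ measurable B, (P B <= (2 * expR (- L))%:E)%E &
    forall w, 0 <= sample_mean X m w <= 1 ->
      4^-1 - e ^+ 2 * m%:R / (2 * L) <=
        (`|sample_mean X m w - 2^-1| - 2 * e / 3) ^+ 2 ->
      e <= `|sample_mean X m w - mu| -> B w].
Proof.
move=> Z01 ZE iid e0 L0 m0.
have [_ mu01] := unit_rv_mean Z01 ZE.
have mR : 0 < m%:R :> R by rewrite ltr0n.
set c := e ^+ 2 * m%:R / (2 * L).
have c0 : 0 < c by rewrite /c divr_gt0 ?mulr_gt0 ?exprn_gt0.
(* The stopping inequality involves exactly this c, for which m Massart exponents add up to L. *)
have cL : expR (- (e ^+ 2 / (2 * c))) ^+ m = expR (- L).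
  rewrite -expRM_natl; congr expR; rewrite /c; field.
  by rewrite !gt_eqF.
have nu01 : 0 <= 1 - mu <= 1 by lra.
have [z0 [t [t0 z0min tb]]] := stopping_threshold mu01 e0 c0.
have [z0' [t' [t0' z0min' tb']]] := stopping_threshold nu01 e0 c0.
have mS (r b : R) :
    measurable [set w | r * (b * m%:R) <= r * \sum_(i < m) X i w].
  apply: measurable_superlevel; apply: measurable_funM => //.
  exact: measurable_sum.
pose U := [set w | t * (z0 * m%:R) <= t * \sum_(i < m) X i w].
(* The lower tail: the threshold z0' obtained for 1 - mu is reflected to 1 - z0', with negative
   tilt. *)
pose D := [set w | - t' * ((1 - z0') * m%:R) <= - t' * \sum_(i < m) X i w].
have PU : (P U <= (expR (- L))%:E)%E.
  apply: le_trans (iid_chernoff t z0 m Z01 ZE iid) _.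
  rewrite lee_fin -cL lerXn2r ?nnegrE ?expR_ge0//.
  by rewrite mulr_ge0 ?expR_ge0//; have := expR_ge0 t; nra.
have PD : (P D <= (expR (- L))%:E)%E.
  apply: le_trans (iid_chernoff (- t') (1 - z0') m Z01 ZE iid) _.
  have -> : expR (- (- t' * (1 - z0'))) * (1 - mu + mu * expR (- t')) =
      expR (- (t' * z0')) * (1 - (1 - mu) + (1 - mu) * expR t').
    have -> : - (- t' * (1 - z0')) = - (t' * z0') + t' by ring.
    rewrite expRD [expR (- t')]expRN; field.
    by rewrite gt_eqF ?expR_gt0.
  rewrite lee_fin -cL lerXn2r ?nnegrE ?expR_ge0//.
  by rewrite mulr_ge0 ?expR_ge0//; have := expR_ge0 t'; nra.
exists (U `|` D); split.
- by apply: measurableU; exact: mS.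
- apply: le_trans (measureU2 _ _ _) _; [exact: mS|exact: mS|].
  by rewrite mulr2n mulrDl mul1r EFinD leeD.
move=> w; set z := sample_mean X m w => z01 rule err.
have SE : \sum_(i < m) X i w = z * m%:R.
  by rewrite /z /sample_mean divfK// gt_eqF.
have [q1 q2] := stopping_rule_quadratic (ltW e0) rule.
have [hz|hz] := leP 0 (z - mu).
  left; rewrite /U /= SE ler_wpM2l// ler_pM2r//.
  by apply: z0min => //; move: err; rewrite ger0_norm//; lra.
right; rewrite /D /= SE !mulNr lerN2 ler_wpM2l// ler_pM2r//.
have : z0' <= 1 - z by apply: z0min' => //; move: err; rewrite ltr0_norm//; lra.
lra.
Qed.

(** * Measurability, null events and the union bound *)

Lemma measurable_find (d : measure_display) (T : measurableType d)
    (I : Type) (a : T -> I -> bool) :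
  (forall i, measurable [set t | a t i]) ->
  forall (r : seq I) k, measurable [set t | find (a t) r = k].
Proof.
move=> ma; elim=> [|i r IH] k.
  by have [->|k0] := eqVneq k 0%N;
    [rewrite (_ : [set _ | _] = setT)|rewrite (_ : [set _ | _] = set0)];
    rewrite ?eqEsubset//; split => // t /=/esym/eqP; rewrite (negbTE k0).
case: k => [|k].
  have -> : [set t | find (a t) (i :: r) = 0%N] = [set t | a t i].
    by apply/seteqP; split => t /=; case: (a t i).
  exact: ma.
have -> : [set t | find (a t) (i :: r) = k.+1] =
    ~` [set t | a t i] `&` [set t | find (a t) r = k].
  apply/seteqP; split => t /=; case: (a t i) => //=;
    [by case|by case|by case=> _ ->].
apply: measurableI; [exact/measurableC/ma|exact: IH].
Qed.

(** The samples share only the law of Z, so they may leave [0, 1], but on a null event; elsewhere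
    all sample means lie in [0, 1], as [stage_error] asks. *)
Lemma sample_outside_null (R : realType) (d d' : measure_display)
    (T : measurableType d) (T' : measurableType d')
    (P : probability T R) (Q : probability T' R)
    (X : nat -> {RV P >-> R}) (Z : {RV Q >-> R}) (i : nat) :
  (forall w, 0 <= Z w <= 1) -> iid_samples X Z ->
  measurable (X i @^-1` (~` `[0, 1])) /\ P (X i @^-1` (~` `[0, 1])) = 0%E.
Proof.
move=> Z01 [_ law].
have mI : measurable (~` `[0, 1] : set R).
  by apply: measurableC; exact: measurable_itv.
split.
  exact: measurable_funPTI.
have := law i _ mI; rewrite /distribution /pushforward => ->.
rewrite (_ : _ @^-1` _ = set0) ?measure0//.
by apply/seteqP; split => // w /=; rewrite in_itv/= Z01.
Qed.

Theorem theorem9 (R : realType)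
    (d' : measure_display) (T' : measurableType d') (Q : probability T' R)
    (Z : {RV Q >-> R}) (mu : R)
    (d : measure_display) (T : measurableType d) (P : probability T R)
    (X : nat -> {RV P >-> R})
    (eps delta : R) (s : nat) (n : nat -> nat)
    (Z_unit : forall t, 0 <= Z t <= 1)
    (Z_mean : 'E_Q[Z]%E = mu%:E)
    (X_iid : iid_samples X Z)
    (eps_range : 0 < eps < 2^-1)
    (delta_range : 0 < delta < 1)
    (s_pos : (0 < s)%N)
    (n_pos : forall l, (1 <= l <= s)%N -> (0 < n l)%N)
    (n_incr : forall k l, (1 <= k)%N -> (k < l)%N -> (l <= s)%N ->
      (n k < n l)%N)
    (n_last : ln (2 * s%:R / delta) / (2 * eps ^+ 2) <= (n s)%:R) :
  ((1 - delta)%:E <=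
     P [set t | (`|sample_mean X (final_size X n s eps delta t) t - mu|
                   < eps)%R])%E.
Proof.
have /andP[e0 _] := eps_range.
have /andP[d0 d1] := delta_range.
have sR : 1 <= s%:R :> R by rewrite ler1n.
set L := ln (2 * s%:R / delta) in n_last.
have arg0 : 0 < 2 * s%:R / delta by rewrite divr_gt0//; lra.
have L0 : 0 < L by rewrite ln_gt0// ltr_pdivlMr//; lra.
have eL : expR (- L) = delta / (2 * s%:R).
  by rewrite expRN lnK ?posrE// invf_div.
have mmean m : measurable_fun [set: T] (sample_mean X m).
  by apply: measurable_funM => //; exact: measurable_sum.
have mstop l : measurable [set t | stop_at X n s eps delta t l].
  apply: measurable_superlevel; apply: measurable_funX.
  apply: measurable_funB => //.
  by apply: measurableT_comp => //; exact: measurable_funB.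
set G := [set t | _].
have mG : measurable G.
  (* Position k in [iota 1 s] is stage k + 1; fixing it makes the random sample size constant. *)
  have GE : G = \bigcup_k
      ([set t | find (stop_at X n s eps delta t) (iota 1 s) = k] `&`
       [set t | `|sample_mean X (n k.+1) t - mu| < eps]).
    apply/seteqP; split => t.
      by move=> Gt; exists (find (stop_at X n s eps delta t) (iota 1 s)).
    by move=> [k _ [/= <-]].
  rewrite GE; apply: bigcupT_measurable => k; apply: measurableI.
    exact: measurable_find.
  rewrite -[X in measurable X]setCK; apply: measurableC.
  rewrite (_ : ~` _ = [set t | eps <= `|sample_mean X (n k.+1) t - mu|]).
    apply: measurable_superlevel; apply: measurableT_comp => //.
    exact: measurable_funB.
  by apply/seteqP; split => t /=; rewrite leNgt => /negP.
(* Positivity of [n l] sits inside the conclusion so that [choice] can pick [B l] for every natural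
   l; the empty set serves when [n l] is 0. *)
have stage (l : nat) : exists B : set T,
    [/\ measurable B, (P B <= (2 * expR (- L))%:E)%E &
    (0 < n l)%N -> forall w, 0 <= sample_mean X (n l) w <= 1 ->
      stop_at X n s eps delta w l ->
      eps <= `|sample_mean X (n l) w - mu| -> B w].
  have [nl|nl] := ltnP 0 (n l).
    have [B [mB PB HB]] := stage_error Z_unit Z_mean X_iid e0 L0 nl.
    by exists B.
  exists set0; split => //.
  by rewrite measure0 lee_fin mulr_ge0 ?expR_ge0.
have [B HB] := choice stage.
have mB l : measurable (B l) by have [] := HB l.
pose N := \bigcup_i (X i @^-1` (~` `[0, 1])).
have N0 : P.-negligible N.
  apply: negligible_bigcup => i.
  have [mN PN] := sample_outside_null i Z_unit X_iid.
  exact/negligibleP.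
have mN : measurable N.
  apply: bigcupT_measurable => i.
  by have [] := sample_outside_null i Z_unit X_iid.
have PN : P N = 0%E by exact/negligibleP.
pose bad := N `|` \big[setU/set0]_(i < s) B i.+1.
have mBad : measurable (\big[setU/set0]_(i < s) B i.+1).
  exact: bigsetU_measurable.
have PGC : (P (~` G) <= delta%:E)%E.
  apply: (@le_trans _ _ (P bad)).
    apply: le_measure; rewrite ?inE; [exact: measurableC|exact: measurableU|].
    move=> t nG; have [Nt|nN] := pselect (N t); [by left|right].
    have X01 i : 0 <= X i t <= 1.
      by apply: contrapT => Xi; apply: nN; exists i.
    have [] := stop_indexP X t s_pos e0 delta_range n_last.
    set l := stop_index X n s eps delta t => ls rule _.
    have nl0 := n_pos _ ls.
    have m01 : 0 <= sample_mean X (n l) t <= 1.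
      have nR : 0 < (n l)%:R :> R by rewrite ltr0n.
      apply/andP; split.
        by rewrite divr_ge0// ?sumr_ge0// => i _; have /andP[] := X01 i.
      rewrite ler_pdivrMr// mul1r.
      have -> : (n l)%:R = \sum_(i < n l) 1 :> R by rewrite sumr_const card_ord.
      by apply: ler_sum => i _; have /andP[] := X01 i.
    have [_ _ /(_ nl0 t m01 rule) Bl] := HB l.
    rewrite -(bigcup_mkord s (fun i => B i.+1)).
    exists (find (stop_at X n s eps delta t) (iota 1 s)).
      by case/andP: ls.
    by apply: Bl; rewrite leNgt; apply/negP.
  apply: le_trans (measureU2 _ _ _) _ => //.
  rewrite [X in (X + _)%E]PN add0e.
  apply: le_trans (@Boole_inequality _ _ _ P (fun i => B i.+1) s _) _ => //.
  apply: (@le_trans _ _ (\sum_(i < s) (2 * expR (- L))%:E)%E).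
    by apply: lee_sum => i _; have [] := HB i.+1.
  (* Each of the s stages contributes 2 delta / (2 s). *)
  rewrite sumEFin lee_fin sumr_const card_ord eL -mulr_natl.
  rewrite le_eqVlt; apply/orP; left; apply/eqP; field.
  by rewrite gt_eqF//; lra.
rewrite -[G]setCK probability_setC; last exact: measurableC.
by rewrite EFinB leeB.
Qed.
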